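(* For every finite set $N$ with $|N| = n \ge 5$, the entropy region $\overline{\mathbf{H}_N^{\mathrm{ent}}}$ is not closed under duality: there exists $h \in \overline{\mathbf{H}_N^{\mathrm{ent}}}$ such that $h^\perp \notin \overline{\mathbf{H}_N^{\mathrm{ent}}}$.
   Context: Let $N$ be a finite index set of size $n$. For jointly distributed discrete random variables $(X_i)_{i\in N}$ (with finite support) and $J\subseteq N$, write $X_J=(X_i)_{i\in J}$ and $H(X_J)$ for its Shannon entropy, with $H(X_\varnothing)=0$. The vector $(H(X_J))_{\varnothing\ne J\subseteq N}\in\mathbb{R}^{2^n-1}$ is called an entropic vector; $\mathbf{H}_N^{\mathrm{ent}}$ denotes the set of all entropic vectors and $\overline{\mathbf{H}_N^{\mathrm{ent}}}$ its topological closure (the entropy region; its elements are called almost entropic). Vectors $h\in\mathbb{R}^{2^n-1}$ are viewed as functions on nonempty subsets of $N$, extended by $h(\varnothing)=0$. The dual of $h$ is the vector $h^\perp$ defined by $h^\perp(J) = h(N\setminus J) - h(N) + \sum_{j\in J} h(\{j\})$ for nonempty $J\subseteq N$. *)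

(* Defs.v *)
From Stdlib Require Import Reals.
From mathcomp Require Import all_boot.

Set Implicit Arguments.
Unset Strict Implicit.
Unset Printing Implicit Defensive.

Local Open Scope R_scope.

Section Entropy.
Variable N : finType.

Definition rsum (T : finType) (F : T -> R) : R := \big[Rplus/0]_(t : T) F t.

(* A joint distribution of random variables (X_i)_{i in N}, each taking
   values in the finite alphabet 'I_k: a pmf on the outcomes {ffun N -> 'I_k}. *)
Definition is_pmf (k : nat) (p : {ffun N -> 'I_k} -> R) : Prop :=
  (forall x, 0 <= p x) /\ rsum p = 1.

(* The value of X_J = (X_i)_{i in J}, encoded as a function N -> option 'I_k
   which is None outside J. *)
Definition proj (k : nat) (J : {set N}) (x : {ffun N -> 'I_k})
  : {ffun N -> option 'I_k} :=
  [ffun i => if i \in J then Some (x i) else None].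

Definition marginal (k : nat) (p : {ffun N -> 'I_k} -> R) (J : {set N})
  (v : {ffun N -> option 'I_k}) : R :=
  \big[Rplus/0]_(x : {ffun N -> 'I_k} | proj J x == v) p x.

Definition shannon (T : finType) (q : T -> R) : R :=
  - rsum (fun v => if Req_EM_T (q v) 0 then 0 else q v * ln (q v)).

Definition entropyJ (k : nat) (p : {ffun N -> 'I_k} -> R) (J : {set N}) : R :=
  shannon (marginal p J).

(* Vectors in R^{2^n - 1} are functions on subsets of N; only the values on
   nonempty subsets are coordinates. *)
Definition entropic (h : {set N} -> R) : Prop :=
  exists (k : nat) (p : {ffun N -> 'I_k} -> R),
    is_pmf p /\ forall J : {set N}, J != set0 -> h J = entropyJ p J.

(* Topological closure in R^{2^n-1} (all norms equivalent; sup-norm used). *)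
Definition almost_entropic (h : {set N} -> R) : Prop :=
  forall eps : R, 0 < eps ->
    exists g, entropic g /\
      forall J : {set N}, J != set0 -> Rabs (h J - g J) < eps.

Definition hext (h : {set N} -> R) (J : {set N}) : R :=
  if J == set0 then 0 else h J.

Definition dual (h : {set N} -> R) (J : {set N}) : R :=
  hext h (~: J) - hext h setT + \big[Rplus/0]_(j in J) hext h [set j].

End Entropy.

(* Main.v *)
From HB Require Import structures.
Require Import Defs.
From Stdlib Require Import Reals Lra.
From mathcomp Require Import all_boot.

(** The inequality of Makarychev, Makarychev, Romashchenko and Vereshchagin,
      I(A:B) <= I(A:B|C) + I(A:B|D) + I(C:D) + I(A:B|E) + I(A:E|B) + I(B:E|A),
    holds for all almost entropic vectors.  It involves E only through its joint law
    with (A,B), so E may be replaced by a copy that is independent of (C,D) given (A,B);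
    the inequality then follows from Shannon inequalities.  Dualizing turns I(X:Y|Z) into
    I(X:Y|N\XYZ), and an explicit distribution on ten equally likely points, in five bits,
    violates the dual inequality: the defect is (9 ln 3 - 14 ln 2) / 5 > 0.  Further
    variables are taken constant. *)

Set Implicit Arguments.
Unset Strict Implicit.
Unset Printing Implicit Defensive.

Local Open Scope R_scope.

(** * Real addition and multiplication as big-operator laws; finite real sums *)

Fact RplusA : associative Rplus. Proof. by move=> x y z; ring. Qed.
Fact RplusC : commutative Rplus. Proof. by move=> x y; ring. Qed.
Fact Rplus0l : left_id 0 Rplus. Proof. by move=> x; ring. Qed.
Fact Rmult0l : left_zero 0 Rmult. Proof. by move=> x; ring. Qed.
Fact Rmult0r : right_zero 0 Rmult. Proof. by move=> x; ring. Qed.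
Fact RmultDl : left_distributive Rmult Rplus. Proof. by move=> x y z; ring. Qed.
Fact RmultDr : right_distributive Rmult Rplus. Proof. by move=> x y z; ring. Qed.

HB.instance Definition _ := Monoid.isComLaw.Build R 0 Rplus RplusA RplusC Rplus0l.
HB.instance Definition _ := Monoid.isMulLaw.Build R 0 Rmult Rmult0l Rmult0r.
HB.instance Definition _ := Monoid.isAddLaw.Build R Rmult Rplus RmultDl RmultDr.

Section FiniteSums.
Variables (T : finType) (P : pred T).

Lemma rsum_ge0 (F : T -> R) :
  (forall x, P x -> 0 <= F x) -> 0 <= \big[Rplus/0]_(x | P x) F x.
Proof. by move=> F0; elim/big_rec: _ => [|x s Px s0]; [lra | have := F0 x Px; lra]. Qed.

Lemma ler_rsum (F G : T -> R) : (forall x, P x -> F x <= G x) ->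
  \big[Rplus/0]_(x | P x) F x <= \big[Rplus/0]_(x | P x) G x.
Proof. by move=> FG; elim/big_rec2: _ => [|x s t Px st]; [lra | have := FG x Px; lra]. Qed.

Lemma rsumN (F : T -> R) :
  \big[Rplus/0]_(x | P x) - F x = - \big[Rplus/0]_(x | P x) F x.
Proof. by elim/big_rec2: _ => [|x s t _ ->]; ring. Qed.

End FiniteSums.

(** * Intersections of equivalence relations, representing joint random variables *)

Definition relI (T : Type) (r r' : rel T) : rel T := fun x y => r x y && r' x y.

Local Notation "r :&&: r'" := (relI r r') (at level 40, left associativity).

Lemma relI_equiv (T : Type) (r r' : rel T) :
  equivalence_rel r -> equivalence_rel r' -> equivalence_rel (r :&&: r').
Proof.
move=> eqr eqr' x y z; rewrite /relI; split; first by rewrite (eqr z z z).1 (eqr' z z z).1.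
by move=> /andP[rxy rxy']; rewrite ((eqr x y z).2 rxy) ((eqr' x y z).2 rxy').
Qed.

Lemma eqrel_sym (T : Type) (r : rel T) : equivalence_rel r -> symmetric r.
Proof.
move=> eqr x y; apply/idP/idP => rxy.
  by rewrite -((eqr x y x).2 rxy) (eqr x x x).1.
by rewrite -((eqr y x y).2 rxy) (eqr y y y).1.
Qed.

(** * Entropy of an equivalence relation and its submodularity *)

Section RelationEntropy.
Variables (T : finType) (p : T -> R).

Definition pmf := (forall x, 0 <= p x) /\ \big[Rplus/0]_x p x = 1.

(* A random variable enters only through its level-set equivalence [r]. *)
Definition mass (r : rel T) (x : T) : R := \big[Rplus/0]_(y | r x y) p y.

(** Shannon entropy as the mean of [- ln] of the class mass. Summing over points avoids the
    quotient, and null points drop out through the factor [p x]. *)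
Definition Hrel (r : rel T) : R := - \big[Rplus/0]_x (p x * ln (mass r x)).

(** Null points affect neither the outer sum nor any class mass. This lets variables that coincide
    almost surely be exchanged. *)
Lemma eq_Hrel (r r' : rel T) :
  (forall x y, p x <> 0 -> p y <> 0 -> r x y = r' x y) -> Hrel r = Hrel r'.
Proof.
move=> rr'; congr (- _); apply: eq_bigr => x _.
have [->|px0] := Req_dec (p x) 0; first by ring.
congr (_ * ln _); rewrite /mass big_mkcond [RHS]big_mkcond; apply: eq_bigr => y _.
by have [->|py0] := Req_dec (p y) 0; [case: ifP; case: ifP | rewrite rr'].
Qed.

Hypothesis p_pmf : pmf.
Let p_ge0 x : 0 <= p x. Proof. by case: p_pmf. Qed.

Lemma mass_ge0 (r : rel T) x : 0 <= mass r x.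
Proof. by apply: rsum_ge0. Qed.

Lemma ler_mass (r : rel T) x : r x x -> p x <= mass r x.
Proof.
move=> rxx; rewrite /mass (bigD1 x) //=.
have : 0 <= \big[Rplus/0]_(y | r x y && (y != x)) p y by apply: rsum_ge0.
lra.
Qed.

Lemma eq_mass (r : rel T) x y : equivalence_rel r -> r x y -> mass r x = mass r y.
Proof. by move=> eqr rxy; apply: eq_bigl => z; rewrite (eqr x y z).2. Qed.

Section Submodularity.
Variables r0 r1 r2 r12 : rel T.
Hypotheses (eq0 : equivalence_rel r0) (eq1 : equivalence_rel r1).
Hypotheses (eq2 : equivalence_rel r2) (eq12 : equivalence_rel r12).
Hypotheses (r10 : subrel r1 r0) (r20 : subrel r2 r0).
Hypothesis r12E : forall x y, r12 x y = r1 x y && r2 x y.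

(** The product [mass r1 * mass r2 / mass r0] is the weight that a conditionally independent
    coupling over [r0] gives to a pair of classes; the pairs that meet carry at most total weight
    1. *)
Lemma submod_weight_le1 :
  \big[Rplus/0]_x (p x * (mass r1 x * mass r2 x / (mass r12 x * mass r0 x))) <= 1.
Proof.
(* Both class masses are expanded over representatives [y] and [z], so that [x] can be summed
   first. *)
pose W x y z := p x * p y * p z / (mass r12 x * mass r0 x).
have -> : \big[Rplus/0]_x (p x * (mass r1 x * mass r2 x / (mass r12 x * mass r0 x))) =
    \big[Rplus/0]_y \big[Rplus/0]_z \big[Rplus/0]_(x | r1 x y && r2 x z) W x y z.
  rewrite (eq_bigr (fun x => \big[Rplus/0]_(y | r1 x y) \big[Rplus/0]_(z | r2 x z) W x y z)).
    rewrite (exchange_big_dep xpredT) //=; apply: eq_bigr => y _.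
    by rewrite (exchange_big_dep xpredT) //=; apply: eq_bigr.
  move=> x _; set c := mass r12 x * mass r0 x.
  rewrite [RHS](_ : _ = p x / c * (mass r1 x * mass r2 x)); last first.
    rewrite /mass big_distrlr /= big_distrr /=; apply: eq_bigr => y _.
    by rewrite big_distrr /=; apply: eq_bigr => z _; rewrite /W -/c /Rdiv; ring.
  by rewrite /Rdiv; ring.
(* For fixed [y] and [z], the admissible [x] are empty or exactly one [r12]-class, whose mass
   cancels the factor [mass r12 x]. *)
apply: (@Rle_trans _ (\big[Rplus/0]_y \big[Rplus/0]_(z | r0 y z) (p y / mass r0 y * p z))).
  apply: ler_rsum => y _; rewrite [X in _ <= X]big_mkcond /=.
  apply: ler_rsum => z _.
  have i0 : 0 <= p y / mass r0 y * p z.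
    apply: Rmult_le_pos => //; apply: Rmult_le_pos => //.
    have [->|n0] := Req_dec (mass r0 y) 0; first by rewrite Rinv_0; lra.
    by left; apply: Rinv_0_lt_compat; have := mass_ge0 r0 y; lra.
  have [x0 /andP[x0y x0z] | no] := pickP (fun x => r1 x y && r2 x z); last first.
    by rewrite big_pred0 //; case: ifP => _ //; lra.
  have -> : r0 y z by rewrite -((eq0 x0 y z).2 (r10 x0y)) r20.
  rewrite (eq_bigr (fun x => p x * (p y * p z / (mass r12 x0 * mass r0 y)))); last first.
    move=> x /andP[xy xz]; rewrite /W.
    have -> : mass r12 x = mass r12 x0.
      apply: eq_mass => //; rewrite r12E.
      by rewrite ((eq1 x y x0).2 xy) (eqrel_sym eq1) x0y ((eq2 x z x0).2 xz) (eqrel_sym eq2) x0z.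
    by rewrite (eq_mass eq0 (r10 xy)) /Rdiv; ring.
  rewrite -big_distrl /= (eq_bigl (r12 x0)) => [|x]; last first.
    rewrite r12E; congr (_ && _).
      by rewrite ((eq1 x0 y x).2 x0y) (eqrel_sym eq1).
    by rewrite ((eq2 x0 z x).2 x0z) (eqrel_sym eq2).
  rewrite -/(mass r12 x0) /Rdiv Rinv_mult.
  (* A null class makes the left side 0, and the right side is nonnegative by [i0]. *)
  have [E|n0] := Req_dec (mass r12 x0) 0.
    by rewrite E Rmult_0_l; move: i0; rewrite /Rdiv; lra.
  right; transitivity (mass r12 x0 * / mass r12 x0 * (p y * / mass r0 y * p z)); first by ring.
  by rewrite Rinv_r //; ring.
rewrite -[X in _ <= X](proj2 p_pmf); apply: ler_rsum => y _.
rewrite -big_distrr /= -/(mass r0 y).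
have [E|n0] := Req_dec (mass r0 y) 0; first by rewrite E Rmult_0_r.
by right; field.
Qed.

(* Gibbs' inequality ln t <= t - 1, averaged at t = m1 m2 / (m12 m0). *)
Lemma Hrel_submod : Hrel r12 + Hrel r0 <= Hrel r1 + Hrel r2.
Proof.
suff : \big[Rplus/0]_x (p x * ln (mass r1 x)) + \big[Rplus/0]_x (p x * ln (mass r2 x)) <=
    (\big[Rplus/0]_x (p x * ln (mass r12 x)) + \big[Rplus/0]_x (p x * ln (mass r0 x)))
    + (\big[Rplus/0]_x (p x * (mass r1 x * mass r2 x / (mass r12 x * mass r0 x)))
       + \big[Rplus/0]_x - p x).
  by rewrite rsumN (proj2 p_pmf) /Hrel; have := submod_weight_le1; lra.
rewrite -!big_split /=; apply: ler_rsum => x _.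
have [->|n0] := Req_dec (p x) 0; first by lra.
have px : 0 < p x by have := p_ge0 x; lra.
have pos (r : rel T) : equivalence_rel r -> 0 < mass r x.
  by move=> eqr; have := ler_mass (eqr x x x).1; lra.
have [[[m0 m1] m2] m12] := (pos _ eq0, pos _ eq1, pos _ eq2, pos _ eq12).
set t := _ / _.
have t0 : 0 < t by apply: Rdiv_lt_0_compat; apply: Rmult_lt_0_compat.
have lnt : ln t = ln (mass r1 x) + ln (mass r2 x) - (ln (mass r12 x) + ln (mass r0 x)).
  rewrite /t /Rdiv ln_mult ?ln_Rinv ?ln_mult //; try exact: Rmult_lt_0_compat.
  by apply: Rinv_0_lt_compat; apply: Rmult_lt_0_compat.
have : ln t <= t - 1 by have := exp_ineq1_le (ln t); rewrite exp_ln //; lra.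
by rewrite lnt => /(Rmult_le_compat_l _ _ _ (p_ge0 x)); lra.
Qed.

End Submodularity.

End RelationEntropy.

(** * Conditionally independent copies and their entropies *)

Section Copy.
Variables (T : finType) (p : T -> R) (s : rel T).
Hypotheses (p_pmf : pmf p) (eqs : equivalence_rel s).

(* Two samples of [p], conditionally independent given their common [s]-class. *)
Definition copy (u : T * T) : R :=
  if s u.1 u.2 then p u.1 * p u.2 / mass p s u.1 else 0.

Let p_ge0 x : 0 <= p x. Proof. by case: p_pmf. Qed.

Lemma copy_supp u : copy u <> 0 -> s u.1 u.2.
Proof. by rewrite /copy; case: ifP. Qed.

Let mass_cancel x : p x * (mass p s x / mass p s x) = p x.
Proof.
have := ler_mass p_pmf (eqs x x x).1; have := p_ge0 x.
have [->|n0 _ _] := Req_dec (mass p s x) 0; last by field.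
move=> p0 px; have -> : p x = 0 by lra.
by ring.
Qed.

(** Summing out the second sample over the [s]-class of [x] leaves [mass p s x / mass p s x],
    harmless because [p x] vanishes wherever that mass does. *)
Lemma copy_expect1 (F : T -> R) :
  \big[Rplus/0]_u (copy u * F u.1) = \big[Rplus/0]_x (p x * F x).
Proof.
rewrite -(pair_bigA _ (fun x y => copy (x, y) * F x)) /=; apply: eq_bigr => x _.
rewrite -(mass_cancel x) {1}/mass /Rdiv big_distrl /= big_distrr /= big_distrl /=.
rewrite [RHS]big_mkcond; apply: eq_bigr => y _; rewrite /copy /=.
by case: ifP => _; rewrite /Rdiv; ring.
Qed.

Lemma copy_expect2 (F : T -> R) :
  \big[Rplus/0]_u (copy u * F u.2) = \big[Rplus/0]_x (p x * F x).
Proof.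
(* [copy] is symmetric, as [mass p s] is constant on [s]-classes, so the second marginal equals the
   first. *)
have swap_inj : injective (fun u : T * T => (u.2, u.1)) by move=> [? ?] [? ?] [-> ->].
rewrite -copy_expect1 (reindex_inj swap_inj) /=.
apply: eq_bigr => -[x y] _; rewrite /copy /= (eqrel_sym eqs y x).
by case: ifP => // sxy; rewrite (eq_mass p eqs sxy) /Rdiv; ring.
Qed.

Lemma copy_pmf : pmf copy.
Proof.
split=> [u|].
  rewrite /copy; case: ifP => _; last by lra.
  apply: Rmult_le_pos; first exact: Rmult_le_pos.
  have [->|n0] := Req_dec (mass p s u.1) 0; first by rewrite Rinv_0; lra.
  by left; apply: Rinv_0_lt_compat; have := mass_ge0 p_pmf s u.1; lra.
have := copy_expect1 (fun=> 1); rewrite -!big_distrl /= (proj2 p_pmf); lra.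
Qed.

Lemma mass_copy1 r u : mass copy (fun u v => r u.1 v.1) u = mass p r u.1.
Proof.
have /= E := copy_expect1 (fun x => if r u.1 x then 1 else 0).
rewrite /mass [LHS]big_mkcond [RHS]big_mkcond /=.
transitivity (\big[Rplus/0]_v (copy v * (if r u.1 v.1 then 1 else 0))).
  by apply: eq_bigr => v _; case: ifP => _; ring.
by rewrite E; apply: eq_bigr => v _; case: ifP => _; ring.
Qed.

Lemma mass_copy2 r u : mass copy (fun u v => r u.2 v.2) u = mass p r u.2.
Proof.
have /= E := copy_expect2 (fun x => if r u.2 x then 1 else 0).
rewrite /mass [LHS]big_mkcond [RHS]big_mkcond /=.
transitivity (\big[Rplus/0]_v (copy v * (if r u.2 v.2 then 1 else 0))).
  by apply: eq_bigr => v _; case: ifP => _; ring.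
by rewrite E; apply: eq_bigr => v _; case: ifP => _; ring.
Qed.

Lemma Hrel_copy1 r : Hrel copy (fun u v => r u.1 v.1) = Hrel p r.
Proof.
rewrite /Hrel -copy_expect1; congr (- _); apply: eq_bigr => u _.
by rewrite mass_copy1.
Qed.

Lemma Hrel_copy2 r : Hrel copy (fun u v => r u.2 v.2) = Hrel p r.
Proof.
rewrite /Hrel -copy_expect2; congr (- _); apply: eq_bigr => u _.
by rewrite mass_copy2.
Qed.

(** Since [r] and [r'] refine [s], on the support of [copy] the mass of a joint class factors as
    [mass r * mass r' / mass s]; the logarithm turns this into the sum. *)
Lemma Hrel_copy12 (r r' : rel T) : equivalence_rel r -> equivalence_rel r' ->
    subrel r s -> subrel r' s ->
  Hrel copy (fun u v => r u.1 v.1 && r' u.2 v.2) = Hrel p r + Hrel p r' - Hrel p s.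
Proof.
move=> eqr eqr' rs rs'.
rewrite /Hrel -[X in - X + _]copy_expect1 -[X in _ + - X]copy_expect2.
rewrite -[X in _ - - X]copy_expect1.
suff -> : \big[Rplus/0]_u (copy u * ln (mass copy (fun u v => r u.1 v.1 && r' u.2 v.2) u)) =
  \big[Rplus/0]_u (copy u * ln (mass p r u.1)) + \big[Rplus/0]_u (copy u * ln (mass p r' u.2))
   + \big[Rplus/0]_u - (copy u * ln (mass p s u.1)) by rewrite rsumN; ring.
rewrite -!big_split /=; apply: eq_bigr => -[x y] _ /=.
have [->|n0] := Req_dec (copy (x, y)) 0; first by ring.
have /= sxy := copy_supp n0.
have [px0 py0] : p x <> 0 /\ p y <> 0.
  by split=> E; apply: n0; rewrite /copy /= sxy E /Rdiv; ring.
have pos z (t : rel T) : p z <> 0 -> equivalence_rel t -> 0 < mass p t z.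
  by move=> pz eqt; have := ler_mass p_pmf (eqt z z z).1; have := p_ge0 z; lra.
suff -> : mass copy (fun u v => r u.1 v.1 && r' u.2 v.2) (x, y) =
    mass p r x * mass p r' y / mass p s x.
  have mr := pos x r px0 eqr; have mr' := pos y r' py0 eqr'; have ms := pos x s px0 eqs.
  rewrite /Rdiv ln_mult ?ln_Rinv ?ln_mult //; first by ring.
    exact: Rmult_lt_0_compat.
  exact: Rinv_0_lt_compat.
(* The product of the two classes lies inside one [s]-class, so the test in [copy] succeeds
   throughout and the double sum splits. *)
rewrite {1}/mass -(pair_big (r x) (r' y) (fun x' y' => copy (x', y'))) /=.
rewrite /Rdiv {1 2}/mass big_distrl /= big_distrl; apply: eq_bigr => x' rx /=.
rewrite Rmult_assoc big_distrl /= big_distrr; apply: eq_bigr => y' ry /=.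
have sxx' := rs _ _ rx; have syy' := rs' _ _ ry.
rewrite /copy /= -(eq_mass p eqs sxx') ifT; first by rewrite /Rdiv; ring.
by rewrite -((eqs x x' y').2 sxx') ((eqs x y y').2 sxy).
Qed.

End Copy.

(** * The five-variable non-Shannon inequality *)

(* Right-hand side minus left-hand side of the MMRV inequality, expanded into entropies. *)
Definition MMRV_expr (hA hB hAB hAC hBC hABC hAD hBD hABD hCD hE hAE hBE hABE : R) : R :=
  3 * hAB + hAC + hBC - hABC + hAD + hBD - hABD - hCD + 2 * hAE + 2 * hBE
  - 3 * hABE - hE - 2 * hA - 2 * hB.

Ltac rel_tauto A B C D E :=
  let x := fresh "x" in let y := fresh "y" in intros x y; rewrite /relI;
  destruct (A x y), (B x y), (C x y), (D x y), (E x y); done.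

(** The three identities say that [E] is independent of [C], of [D] and of their join, given [A] and
    [B]. The claim is the plain sum of eight Shannon inequalities after substituting them:
    [I(C:D|E)], [I(AB:E|CD)], [I(A:B|CE)], [I(A:B|DE)], and [I(C:E|.)], [I(D:E|.)] given [A] or
    given [B], are all nonnegative. *)
Lemma MMRV_of_cond_indep (T : finType) (p : T -> R) (A B C D E : rel T) :
  pmf p -> equivalence_rel A -> equivalence_rel B -> equivalence_rel C ->
  equivalence_rel D -> equivalence_rel E ->
  let H := Hrel p in let AB := A :&&: B in let ABE := AB :&&: E in
  H (AB :&&: C :&&: E) = H (AB :&&: C) + H ABE - H AB ->
  H (AB :&&: D :&&: E) = H (AB :&&: D) + H ABE - H AB ->
  H (AB :&&: (C :&&: D) :&&: E) = H (AB :&&: (C :&&: D)) + H ABE - H AB ->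
  0 <= MMRV_expr (H A) (H B) (H AB) (H (A :&&: C)) (H (B :&&: C)) (H (AB :&&: C))
         (H (A :&&: D)) (H (B :&&: D)) (H (AB :&&: D)) (H (C :&&: D))
         (H E) (H (A :&&: E)) (H (B :&&: E)) (H ABE).
Proof.
move=> p_pmf eA eB eC eD eE H AB ABE iC iD iCD; rewrite /ABE /AB in iC iD iCD; rewrite /MMRV_expr /ABE /AB.
have sub r0 r1 r2 r12 : equivalence_rel r0 -> equivalence_rel r1 -> equivalence_rel r2 ->
    equivalence_rel r12 -> subrel r1 r0 -> subrel r2 r0 ->
    (forall x y, r12 x y = r1 x y && r2 x y) -> H r12 + H r0 <= H r1 + H r2.
  exact: Hrel_submod.
have CD_E : H (C :&&: D :&&: E) + H E <= H (C :&&: E) + H (D :&&: E).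
  by apply: sub => //; do ?apply: relI_equiv => //; rel_tauto A B C D E.
have ABE_CD : H (A :&&: B :&&: (C :&&: D) :&&: E) + H (C :&&: D) <=
    H (A :&&: B :&&: (C :&&: D)) + H (C :&&: D :&&: E).
  by apply: sub => //; do ?apply: relI_equiv => //; rel_tauto A B C D E.
have AB_CE : H (A :&&: B :&&: C :&&: E) + H (C :&&: E) <=
    H (A :&&: C :&&: E) + H (B :&&: C :&&: E).
  by apply: sub => //; do ?apply: relI_equiv => //; rel_tauto A B C D E.
have AB_DE : H (A :&&: B :&&: D :&&: E) + H (D :&&: E) <=
    H (A :&&: D :&&: E) + H (B :&&: D :&&: E).
  by apply: sub => //; do ?apply: relI_equiv => //; rel_tauto A B C D E.
have CE_A : H (A :&&: C :&&: E) + H A <= H (A :&&: C) + H (A :&&: E).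
  by apply: sub => //; do ?apply: relI_equiv => //; rel_tauto A B C D E.
have CE_B : H (B :&&: C :&&: E) + H B <= H (B :&&: C) + H (B :&&: E).
  by apply: sub => //; do ?apply: relI_equiv => //; rel_tauto A B C D E.
have DE_A : H (A :&&: D :&&: E) + H A <= H (A :&&: D) + H (A :&&: E).
  by apply: sub => //; do ?apply: relI_equiv => //; rel_tauto A B C D E.
have DE_B : H (B :&&: D :&&: E) + H B <= H (B :&&: D) + H (B :&&: E).
  by apply: sub => //; do ?apply: relI_equiv => //; rel_tauto A B C D E.
lra.
Qed.

(** [C] and [D] are read off the first sample and [E] off the second, with [A] and [B] shared by
    both; each of the fourteen entropies is then preserved. *)
Theorem MMRV_inequality (T : finType) (p : T -> R) (A B C D E : rel T) :
  pmf p -> equivalence_rel A -> equivalence_rel B -> equivalence_rel C ->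
  equivalence_rel D -> equivalence_rel E -> let H := Hrel p in
  0 <= MMRV_expr (H A) (H B) (H (A :&&: B)) (H (A :&&: C)) (H (B :&&: C)) (H (A :&&: B :&&: C))
         (H (A :&&: D)) (H (B :&&: D)) (H (A :&&: B :&&: D)) (H (C :&&: D))
         (H E) (H (A :&&: E)) (H (B :&&: E)) (H (A :&&: B :&&: E)).
Proof.
move=> p_pmf eA eB eC eD eE H.
have eAB := relI_equiv eA eB; have eABE := relI_equiv eAB eE.
pose q := copy p (A :&&: B).
pose fst_rel (r : rel T) : rel (T * T) := fun u v => r u.1 v.1.
pose snd_rel (r : rel T) : rel (T * T) := fun u v => r u.2 v.2.
have fst_equiv r : equivalence_rel r -> equivalence_rel (fst_rel r).
  by move=> eqr x y z; apply: eqr.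
have H1 r : Hrel q (fst_rel r) = H r by exact: Hrel_copy1.
have H2 r : Hrel q (snd_rel r) = H r by exact: Hrel_copy2.
(* On the support the two samples share their class for [A :&&: B], so anything it determines can be
   read off either one. *)
have transfer r u v : equivalence_rel r -> subrel (A :&&: B) r -> q u <> 0 -> q v <> 0 ->
    fst_rel r u v = snd_rel r u v.
  move=> eqr sub /copy_supp/sub u12 /copy_supp/sub v12; rewrite /fst_rel /snd_rel.
  by rewrite ((eqr _ _ _).2 u12) !(eqrel_sym eqr u.2) ((eqr _ _ _).2 v12).
have AB_A : subrel (A :&&: B) A by move=> x y /andP[].
have AB_B : subrel (A :&&: B) B by move=> x y /andP[].
have HE r : equivalence_rel r -> subrel (A :&&: B) r ->
    Hrel q (fst_rel r :&&: snd_rel E) = H (r :&&: E).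
  move=> eqr sub; rewrite -H2; apply: eq_Hrel => u v qu qv.
  by rewrite /relI (transfer r).
have indep F : equivalence_rel F ->
    Hrel q (fst_rel (A :&&: B :&&: F) :&&: snd_rel E) =
    H (A :&&: B :&&: F) + H (A :&&: B :&&: E) - H (A :&&: B).
  move=> eF; rewrite -Hrel_copy12 //; try by [apply: relI_equiv | move=> x y /andP[]].
  (* Joining [A :&&: B] to [E] in the second sample changes nothing on the support, and supplies the
     refinement of [A :&&: B] that [Hrel_copy12] requires. *)
  apply: eq_Hrel => u v qu qv; have := transfer _ _ _ eAB (fun _ _ => id) qu qv.
  rewrite /fst_rel /snd_rel /relI => <-.
  by case: (A _ _); case: (B _ _); case: (F _ _).
rewrite -(HE A) // -(HE B) // -(HE (A :&&: B)) // -(H2 E) -!H1.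
have := @MMRV_of_cond_indep _ q (fst_rel A) (fst_rel B) (fst_rel C) (fst_rel D) (snd_rel E).
apply; rewrite ?(HE (A :&&: B)) ?indep //; try exact: fst_equiv.
- exact: copy_pmf.
- by move=> x y z; apply: eE.
- by rewrite -(H1 (A :&&: B :&&: C)) -(H1 (A :&&: B)).
- by rewrite -(H1 (A :&&: B :&&: D)) -(H1 (A :&&: B)).
- have := indep _ (relI_equiv eC eD).
  by rewrite -(H1 (A :&&: B :&&: (C :&&: D))) -(H1 (A :&&: B)).
Qed.

(** * The inequality for entropic and almost entropic vectors *)

Section Entropic.
Variable N : finType.

Definition agree (k : nat) (J : {set N}) : rel {ffun N -> 'I_k} :=
  fun x y => proj J x == proj J y.

Lemma agreeP (k : nat) (J : {set N}) (x y : {ffun N -> 'I_k}) :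
  reflect {in J, x =1 y} (agree J x y).
Proof.
apply: (iffP eqP) => [/ffunP xy i iJ | xy].
  by have := xy i; rewrite !ffunE iJ => -[].
by apply/ffunP => i; rewrite !ffunE; case: ifP => // iJ; rewrite xy.
Qed.

Lemma agree_equiv (k : nat) (J : {set N}) : equivalence_rel (@agree k J).
Proof. by move=> x y z; split=> [|/eqP xy]; rewrite /agree ?eqxx ?xy. Qed.

Lemma agreeU (k : nat) (I J : {set N}) (x y : {ffun N -> 'I_k}) :
  agree (I :|: J) x y = agree I x y && agree J x y.
Proof.
apply/agreeP/andP => [xy | [/agreeP xyI /agreeP xyJ] i].
  by split; apply/agreeP => i iI; apply: xy; rewrite inE iI ?orbT.
by rewrite inE => /orP[/xyI | /xyJ].
Qed.

(** Grouping points by their projection turns the sum over values of [X_J] into a sum over points;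
    values of marginal 0 contribute nothing. *)
Lemma entropyJE (k : nat) (p : {ffun N -> 'I_k} -> R) (J : {set N}) :
  entropyJ p J = Hrel p (@agree k J).
Proof.
rewrite /entropyJ /shannon /Hrel /rsum; congr (- _).
rewrite [RHS](partition_big (proj J) xpredT) //=; apply: eq_bigr => v _.
transitivity (marginal p J v * ln (marginal p J v)).
  by case: Req_EM_T => //= m0; rewrite m0 Rmult_0_l.
rewrite {1}/marginal big_distrl /=; apply: eq_bigr => x /eqP xv.
by congr (_ * ln _); apply: eq_bigl => y; rewrite /agree xv eq_sym.
Qed.

Definition MMRV_at (h : {set N} -> R) (a b c d e : N) : R :=
  MMRV_expr (h [set a]) (h [set b]) (h [set a; b]) (h [set a; c]) (h [set b; c])
    (h [set a; b; c]) (h [set a; d]) (h [set b; d]) (h [set a; b; d]) (h [set c; d])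
    (h [set e]) (h [set a; e]) (h [set b; e]) (h [set a; b; e]).

Lemma set1_neq0 (a : N) : [set a] != set0.
Proof. by apply/set0Pn; exists a; rewrite inE. Qed.

Lemma setU_neq0 (J : {set N}) (a : N) : J :|: [set a] != set0.
Proof. by apply/set0Pn; exists a; rewrite !inE eqxx orbT. Qed.

Lemma entropic_MMRV (h : {set N} -> R) (a b c d e : N) :
  entropic h -> 0 <= MMRV_at h a b c d e.
Proof.
move=> [k [p [p_pmf hE]]].
have hU (J : {set N}) x : h (J :|: [set x]) = Hrel p (relI (@agree k J) (@agree k [set x])).
  rewrite hE ?setU_neq0 // entropyJE; apply: eq_Hrel => u v _ _; exact: agreeU.
have h1 x : h [set x] = Hrel p (@agree k [set x]) by rewrite hE ?set1_neq0 // entropyJE.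
have hUU x y z : h [set x; y; z] =
    Hrel p (relI (relI (@agree k [set x]) (@agree k [set y])) (@agree k [set z])).
  by rewrite hU; apply: eq_Hrel => u v _ _; rewrite /relI agreeU.
rewrite /MMRV_at !hUU !hU !h1; apply: MMRV_inequality; by [|apply: agree_equiv].
Qed.

Lemma almost_entropic_MMRV (h : {set N} -> R) (a b c d e : N) :
  almost_entropic h -> 0 <= MMRV_at h a b c d e.
Proof.
move=> h_ae; apply: Rnot_lt_le => neg.
(* 22 is the sum of the absolute values of the coefficients in [MMRV_expr], so such a [g] would
   still make the expression negative. *)
have [g [g_ent hg]] := h_ae (- MMRV_at h a b c d e / 22) ltac:(lra).
have := entropic_MMRV a b c d e g_ent.
have near J : J != set0 -> h J - g J < - MMRV_at h a b c d e / 22 /\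
    g J - h J < - MMRV_at h a b c d e / 22.
  by move=> /hg/Rabs_def2; lra.
have nearU (J : {set N}) x := near _ (setU_neq0 J x).
have near1 x := near _ (set1_neq0 x).
move: (near1 a) (near1 b) (near1 e) (nearU [set a] b) (nearU [set a] c) (nearU [set b] c)
  (nearU [set a; b] c) (nearU [set a] d) (nearU [set b] d) (nearU [set a; b] d)
  (nearU [set c] d) (nearU [set a] e) (nearU [set b] e) (nearU [set a; b] e).
move: neg; rewrite /MMRV_at /MMRV_expr; lra.
Qed.

End Entropic.

(** * Uniform distributions on a list of bit rows, counted with multiplicity *)

Section EmpiricalDistribution.
Variables (N : finType) (s : seq N) (rows : seq bitseq).
Hypotheses (s_uniq : uniq s) (rows_size : all (fun r => size r == size s) rows).
Hypothesis rows_n0 : (0 < size rows)%N.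

(* Coordinates outside [s] are constant, as [nth] falls back on its default there. *)
Definition point (r : bitseq) : {ffun N -> 'I_2} :=
  [ffun i => inord (nth false r (index i s))].

Definition empirical (x : {ffun N -> 'I_2}) : R :=
  \big[Rplus/0]_(r <- rows | point r == x) / INR (size rows).

Let w_gt0 : 0 < INR (size rows). Proof. by apply: lt_0_INR; apply/ltP. Qed.

Lemma empirical_expect (F : {ffun N -> 'I_2} -> R) :
  \big[Rplus/0]_x (empirical x * F x) =
  / INR (size rows) * \big[Rplus/0]_(r <- rows) F (point r).
Proof.
rewrite big_distrr /= (eq_bigr (fun x => \big[Rplus/0]_(r <- rows | point r == x)
  (/ INR (size rows) * F (point r)))) => [|x _].
  rewrite (exchange_big_dep xpredT) //=; apply: eq_bigr => r _.
  by rewrite (big_pred1 (point r)) // => x; rewrite eq_sym.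
by rewrite big_distrl; apply: eq_bigr => r /eqP ->.
Qed.

Lemma rsum_indicator (P : pred bitseq) (l : seq bitseq) :
  \big[Rplus/0]_(r <- l) (if P r then 1 else 0) = INR (count P l).
Proof.
elim: l => [|r l IH]; rewrite ?big_nil // big_cons IH /= plus_INR.
by case: (P r).
Qed.

Lemma empirical_pmf : pmf empirical.
Proof.
split=> [x|].
  rewrite /empirical; elim/big_rec: _ => [|r y _ y0]; first by lra.
  by have := Rinv_0_lt_compat _ w_gt0; lra.
have := empirical_expect (fun=> 1); rewrite -big_distrl /= Rmult_1_r => ->.
rewrite (rsum_indicator xpredT) count_predT; field; lra.
Qed.

Lemma mass_empirical (e : rel {ffun N -> 'I_2}) x :
  mass empirical e x = INR (count (fun r => e x (point r)) rows) / INR (size rows).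
Proof.
transitivity (\big[Rplus/0]_y (empirical y * (if e x y then 1 else 0))).
  by rewrite /mass big_mkcond; apply: eq_bigr => y _; case: ifP => _; ring.
by rewrite empirical_expect (rsum_indicator (fun r => e x (point r))) /Rdiv Rmult_comm.
Qed.

(** Replaces equality of projections over an abstract [N] by equality of masked bit lists, which can
    be computed. *)
Lemma agree_point (J : {set N}) (r r' : bitseq) :
    size r = size s -> size r' = size s ->
  agree J (point r) (point r') =
  (mask [seq i \in J | i <- s] r == mask [seq i \in J | i <- s] r').
Proof.
move=> sz sz'.
have rE t : size t = size s -> t = [seq nth false t (index i s) | i <- s].
  move=> st; apply: (@eq_from_nth _ false); rewrite ?size_map // => k kt.
  (* [nth_map] needs a default element of [N]; one exists because [k] is a valid position, so [s] is
     nonempty. *)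
  have [i0 _] : exists i : N, i \in s.
    by case: (s) st kt => [|i l _ _]; [move/size0nil=> -> | exists i; rewrite mem_head].
  by rewrite (nth_map i0) -?st // index_uniq -?st.
rewrite {2}(rE r sz) {2}(rE r' sz') -!map_mask -filter_mask.
apply/agreeP/eqP => [rr' | /eq_in_map rr' i iJ].
  apply/eq_in_map => i; rewrite mem_filter => /andP[iJ _].
  have := rr' i iJ; rewrite !ffunE => /(congr1 (@nat_of_ord 2)); rewrite !inordK ?ltnS ?leq_b1 //.
  by do 2!case: nth.
rewrite !ffunE; have [is_s|is_s] := boolP (i \in s).
  by rewrite rr' // mem_filter iJ.
(* Outside [s] the index equals [size s], so both points take the default bit. *)
by rewrite (memNindex is_s) !nth_default ?sz ?sz'.
Qed.

(** The class mass of a row is the number of rows matching it under the mask, divided by the number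
    of rows; entropy thus reduces to counting. *)
Lemma entropyJ_empirical (J : {set N}) :
  let m := [seq i \in J | i <- s] in
  entropyJ empirical J = ln (INR (size rows)) -
    / INR (size rows) * \big[Rplus/0]_(r <- rows)
       ln (INR (count (fun r' => mask m r == mask m r') rows)).
Proof.
move=> m; rewrite entropyJE /Hrel.
rewrite (empirical_expect (fun x => ln (mass empirical (@agree _ 2 J) x))).
have -> : \big[Rplus/0]_(r <- rows) ln (mass empirical (@agree _ 2 J) (point r)) =
    \big[Rplus/0]_(r <- rows) (ln (INR (count (fun r' => mask m r == mask m r') rows))
      + - ln (INR (size rows)) * if xpredT r then 1 else 0).
  rewrite big_seq [RHS]big_seq; apply: eq_bigr => r rr /=.
  have sz := eqP (allP rows_size _ rr).
  rewrite mass_empirical; set c := count _ _.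
  have -> : c = count (fun r' => mask m r == mask m r') rows.
    by apply: eq_in_count => r' rr'; rewrite agree_point // (eqP (allP rows_size _ rr')).
  rewrite ln_mult ?ln_Rinv //; first by rewrite Rmult_1_r.
    apply: lt_0_INR; apply/ltP; rewrite -has_count; apply/hasP; exists r => //.
  exact: Rinv_0_lt_compat.
rewrite big_split /= -big_distrr /= (rsum_indicator xpredT) count_predT; field; lra.
Qed.

End EmpiricalDistribution.

(** * Effect of duality on the inequality *)

Lemma entropyJ0 (N : finType) (k : nat) (p : {ffun N -> 'I_k} -> R) :
  pmf p -> entropyJ p set0 = 0.
Proof.
move=> [_ p1]; rewrite entropyJE /Hrel big1 ?Ropp_0 // => x _.
have -> : mass p (@agree N k set0) x = 1.
  by rewrite -p1; apply: eq_bigl => y; apply/agreeP => i; rewrite inE.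
by rewrite ln_1 Rmult_0_r.
Qed.

(* The inequality is balanced: the terms [h [set j]] and [h setT] cancel. *)
Lemma MMRV_dual (N : finType) (h : {set N} -> R) (a b c d e : N) :
  h set0 = 0 -> uniq [:: a; b; c; d; e] ->
  MMRV_at (dual h) a b c d e = MMRV_at (fun J => h (~: J)) a b c d e.
Proof.
move=> h0; rewrite /= !inE !negb_or => /and5P[/and4P[ab ac ad ae] /and3P[bc bd be]].
move=> /andP[cd ce] _ _.
(* [hext] could differ from [h] only at the empty set, where [h0] gives the same value. *)
have hextE J : hext h J = h J by rewrite /hext; case: eqP => // ->.
have dualU (J : {set N}) x : x \notin J -> \big[Rplus/0]_(j in J :|: [set x]) hext h [set j] =
    \big[Rplus/0]_(j in J) hext h [set j] + h [set x].
  by move=> xJ; rewrite setUC big_setU1 //= hextE Rplus_comm.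
have [ba ca da ea] : [/\ b != a, c != a, d != a & e != a] by rewrite !(eq_sym _ a).
have [cb db eb dc] : [/\ c != b, d != b, e != b & d != c] by rewrite !(eq_sym _ b) (eq_sym d).
rewrite /MMRV_at /MMRV_expr /dual !dualU ?inE ?negb_or ?ba ?ca ?da ?ea ?cb ?db ?eb ?dc //.
by rewrite !big_set1 !hextE; ring.
Qed.

(** * The ten-point example *)

(* Coordinates (a,b,c,d,e): given e = 0, c = ~~a && b and d = a && ~~b.  Repeated rows
   carry double weight. *)
Definition rows10 : seq bitseq :=
  [seq [seq (b == 1)%N | b <- r] | r <-
    [:: [:: 0; 0; 0; 0; 0]; [:: 1; 1; 0; 0; 0]; [:: 0; 1; 1; 0; 0]; [:: 0; 1; 1; 0; 0];
        [:: 1; 0; 0; 1; 0]; [:: 1; 0; 0; 1; 0]; [:: 0; 0; 0; 0; 1]; [:: 1; 0; 0; 0; 1];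
        [:: 0; 1; 0; 0; 1]; [:: 1; 1; 0; 0; 1]]]%N.

Definition class_sizes (m : bitseq) : seq nat :=
  [seq count (fun r' => mask m r == mask m r') rows10 | r <- rows10].

(** The class sizes have no prime factors but 2 and 3, so these totals for [q] equal to 2 and 3 fix
    the sum of their logarithms. *)
Definition total_logn (q : nat) (m : bitseq) : nat := sumn [seq logn q k | k <- class_sizes m].

Lemma ln_INR_2_3 (k : nat) : k \in [:: 1; 2; 3; 4; 6]%N ->
  ln (INR k) = INR (logn 2 k) * ln 2 + INR (logn 3 k) * ln 3.
Proof.
have -> : [:: 1; 2; 3; 4; 6]%N = [:: 2 ^ 0 * 3 ^ 0; 2 ^ 1 * 3 ^ 0; 2 ^ 0 * 3 ^ 1; 2 ^ 2 * 3 ^ 0;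
  2 ^ 1 * 3 ^ 1]%N by [].
suff {k} E i j : ln (INR (2 ^ i * 3 ^ j)) = INR i * ln 2 + INR j * ln 3.
  by rewrite !inE => /or4P[| | |/orP[]] /eqP ->; exact: E.
have pos n m : (0 < n)%N -> 0 < INR (n ^ m).
  by move=> n0; apply: lt_0_INR; apply/ltP; rewrite expn_gt0 n0.
have pow n m : INR (n ^ m) = (INR n ^ m)%R.
  by elim: m => //= m IH; rewrite expnS -multE mult_INR IH.
rewrite -multE mult_INR ln_mult; [|exact: pos..].
have [E2 E3] : INR 2 = 2 /\ INR 3 = 3 by rewrite /=; split; ring.
by rewrite !pow E2 E3 !ln_pow; lra.
Qed.

Section Example.
Variables (N : finType) (a b c d e : N).
Hypothesis s_uniq : uniq [:: a; b; c; d; e].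

Definition h10 : {set N} -> R := entropyJ (empirical [:: a; b; c; d; e] rows10).

(** The mask marks the listed variables outside [J], because the dualized inequality evaluates
    entropies at complements; the remaining variables are constant. *)
Lemma h10E (J : {set N}) (m : bitseq) : [seq i \notin J | i <- [:: a; b; c; d; e]] = m ->
  all [in [:: 1; 2; 3; 4; 6]%N] (class_sizes m) ->
  h10 (~: J) = ln (INR 10) -
    / INR 10 * (INR (total_logn 2 m) * ln 2 + INR (total_logn 3 m) * ln 3).
Proof.
move=> Jm sizes; rewrite /h10 entropyJ_empirical //.
have -> : [seq i \in ~: J | i <- [:: a; b; c; d; e]] = m by rewrite -Jm /= !inE.
congr (_ - _ * _); rewrite -(big_map (fun r => count (fun r' => mask m r == mask m r') rows10)
  xpredT (fun k => ln (INR k))) -/(class_sizes m) /total_logn.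
elim: (class_sizes m) sizes => [_|k l IH /= /andP[k_in /IH {}IH]].
  by rewrite big_nil /=; ring.
by rewrite big_cons IH ln_INR_2_3 // !plus_INR; ring.
Qed.

Lemma MMRV_dual_h10_lt0 : MMRV_at (dual h10) a b c d e < 0.
Proof.
have h0 : h10 set0 = 0 by apply: entropyJ0; apply: empirical_pmf.
rewrite (MMRV_dual h0 s_uniq) /MMRV_at /MMRV_expr.
move: s_uniq; rewrite /= !inE !negb_or.
move=> /and5P[/and4P[ab ac ad ae] /and3P[bc bd be] /andP[cd ce] de _].
have [ba ca da ea] : [/\ b != a, c != a, d != a & e != a] by rewrite !(eq_sym _ a).
have [cb db eb dc] : [/\ c != b, d != b, e != b & d != c] by rewrite !(eq_sym _ b) (eq_sym d).
have [ec ed] : e != c /\ e != d by rewrite !(eq_sym e).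
have neqs := (negPf ab, negPf ac, negPf ad, negPf ae, negPf bc, negPf bd, negPf be, negPf cd,
  negPf ce, negPf de, negPf ba, negPf ca, negPf da, negPf ea, negPf cb, negPf db, negPf eb,
  negPf dc, negPf ec, negPf ed).
rewrite (@h10E [set a] [:: false; true; true; true; true]); [|by rewrite /= !inE ?eqxx ?neqs|by vm_compute].
rewrite (@h10E [set b] [:: true; false; true; true; true]); [|by rewrite /= !inE ?eqxx ?neqs|by vm_compute].
rewrite (@h10E [set a; b] [:: false; false; true; true; true]); [|by rewrite /= !inE ?eqxx ?neqs|by vm_compute].
rewrite (@h10E [set a; c] [:: false; true; false; true; true]); [|by rewrite /= !inE ?eqxx ?neqs|by vm_compute].
rewrite (@h10E [set b; c] [:: true; false; false; true; true]); [|by rewrite /= !inE ?eqxx ?neqs|by vm_compute].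
rewrite (@h10E [set a; b; c] [:: false; false; false; true; true]); [|by rewrite /= !inE ?eqxx ?neqs|by vm_compute].
rewrite (@h10E [set a; d] [:: false; true; true; false; true]); [|by rewrite /= !inE ?eqxx ?neqs|by vm_compute].
rewrite (@h10E [set b; d] [:: true; false; true; false; true]); [|by rewrite /= !inE ?eqxx ?neqs|by vm_compute].
rewrite (@h10E [set a; b; d] [:: false; false; true; false; true]); [|by rewrite /= !inE ?eqxx ?neqs|by vm_compute].
rewrite (@h10E [set c; d] [:: true; true; false; false; true]); [|by rewrite /= !inE ?eqxx ?neqs|by vm_compute].
rewrite (@h10E [set e] [:: true; true; true; true; false]); [|by rewrite /= !inE ?eqxx ?neqs|by vm_compute].
rewrite (@h10E [set a; e] [:: false; true; true; true; false]); [|by rewrite /= !inE ?eqxx ?neqs|by vm_compute].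
rewrite (@h10E [set b; e] [:: true; false; true; true; false]); [|by rewrite /= !inE ?eqxx ?neqs|by vm_compute].
rewrite (@h10E [set a; b; e] [:: false; false; true; true; false]); [|by rewrite /= !inE ?eqxx ?neqs|by vm_compute].
(* This is [2 ^ 14 = 16384 < 19683 = 3 ^ 9]. *)
have key : 14 * ln 2 < 9 * ln 3.
  have <- : INR 14 = 14 by rewrite INR_IZR_INZ.
  have <- : INR 9 = 9 by rewrite INR_IZR_INZ.
  by rewrite -!ln_pow; try apply: ln_increasing; lra.
repeat match goal with |- context[total_logn ?q ?m] =>
  let v := eval vm_compute in (total_logn q m) in change (total_logn q m) with v end.
(* The terms [ln 10] cancel, as the coefficients of [MMRV_expr] sum to 0. *)
rewrite !INR_IZR_INZ /=; lra.
Qed.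

End Example.

(** * Failure of closure under duality *)

Theorem mainTheorem1 (N : finType) (hN : (5 <= #|N|)%N) :
  exists h : {set N} -> R,
    almost_entropic h /\ ~ almost_entropic (dual h).
Proof.
have [a [b [c [d [e s_uniq]]]]] : exists a b c d e : N, uniq [:: a; b; c; d; e].
  have : size (take 5 (enum N)) = 5%N by rewrite size_takel // -cardE.
  have : uniq (take 5 (enum N)) by rewrite take_uniq // enum_uniq.
  by case: (take 5 _) => [|a [|b [|c [|d [|e []]]]]] // s_uniq _; exists a, b, c, d, e.
exists (h10 a b c d e); split=> [eps eps0 | /(almost_entropic_MMRV a b c d e)].
  (* [h10] is itself entropic, so it serves as its own approximation for every [eps]. *)
  exists (h10 a b c d e); split=> [|J _]; last by rewrite Rminus_diag Rabs_R0.
  exists 2%N, (empirical [:: a; b; c; d; e] rows10); split=> //; exact: empirical_pmf.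
by have := MMRV_dual_h10_lt0 s_uniq; lra.
Qed.
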